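(* Let $X$ be an infinite-dimensional complex Banach space and let $T$ be a generalized Drazin invertible bounded linear operator on $X$ with generalized Drazin inverse $T^D$. If $T$ has property $(\delta)$, then $T^D$ has property $(\delta)$; and if $T$ is decomposable, then $T^D$ is decomposable.
   Context: A bounded operator $T$ on $X$ is generalized Drazin invertible if there is a bounded operator $S$ on $X$ with $ST=TS$, $STS=S$ and $TST=T+U$ with $U$ quasinilpotent (equivalently, $0$ is not an accumulation point of $\sigma(T)$). Such $S$ is unique; it is called the generalized Drazin inverse of $T$ and denoted $T^D$. The local resolvent set $\rho_T(x)$ of $T$ at $x\in X$ is the union of all open sets $U\subseteq\mathbb{C}$ for which there is an analytic function $f:U\to X$ with $(\lambda I-T)f(\lambda)=x$ for all $\lambda\in U$; the local spectrum is $\sigma_T(x)=\mathbb{C}\setminus\rho_T(x)$. For $\Omega\subseteq\mathbb{C}$, $X_T(\Omega)=\{x\in X:\sigma_T(x)\subset\Omega\}$. $T$ has the decomposition property $(\delta)$ if $X=X_T(\overline{U})+X_T(\overline{V})$ for every open cover $\{U,V\}$ of $\mathbb{C}$. $T$ has (Bishop's) property $(\beta)$ if for every open set $\mathcal{U}\subseteq\mathbb{C}$ and every sequence of analytic functions $f_n:\mathcal{U}\to X$ for which $(\lambda I-T)f_n(\lambda)\to0$ uniformly on all compact subsets of $\mathcal{U}$, also $f_n(\lambda)\to0$ uniformly on all compact subsets of $\mathcal{U}$. $T$ is decomposable if it has both property $(\beta)$ and property $(\delta)$. *)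

(* Defs.v *)
From Stdlib Require Import Reals List.
From Coquelicot Require Import Coquelicot.

Open Scope R_scope.

(* A complex Banach space is a [CompleteNormedModule C_AbsRing], and a bounded
   operator on it is a function satisfying Coquelicot's [is_linear], which
   includes boundedness. *)

Definition infinite_dimensional (X : CompleteNormedModule C_AbsRing) : Prop :=
  ~ exists (n : nat) (e : nat -> X), forall x : X,
      exists c : nat -> C, x = sum_n (fun k => scal (c k : C_AbsRing) (e k)) n.

Definition closure (D : C -> Prop) : C -> Prop :=
  fun z => forall P : C -> Prop, locally z P -> exists w : C, P w /\ D w.

Definition compact_set (K : C -> Prop) : Prop :=
  forall F : (C -> Prop) -> Prop,
    (forall O, F O -> open O) ->
    (forall z, K z -> exists O, F O /\ O z) ->
    exists L : list (C -> Prop),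
      (forall O, In O L -> F O) /\
      (forall z, K z -> exists O, In O L /\ O z).

Section Operators.

Variable X : CompleteNormedModule C_AbsRing.

(* Functions on a subset of C are represented by total functions whose values
   outside the subset are irrelevant. *)
Definition analytic_on (U : C -> Prop) (f : C -> X) : Prop :=
  forall z0 : C, U z0 ->
    exists (a : nat -> X) (r : R), 0 < r /\
      forall z : C, Cmod (z - z0)%C < r ->
        is_pseries a ((z - z0)%C : C_AbsRing) (f z).

Definition uniform_null_on (K : C -> Prop) (g : nat -> C -> X) : Prop :=
  forall eps : R, 0 < eps ->
    exists N : nat, forall n : nat, (N <= n)%nat ->
      forall z : C, K z -> norm (g n z) < eps.

Definition shift (T : X -> X) (z : C) (x : X) : X :=
  minus (scal (z : C_AbsRing) x) (T x).

Definition invertible (A : X -> X) : Prop :=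
  exists B : X -> X, is_linear B /\
    (forall x, A (B x) = x) /\ (forall x, B (A x) = x).

Definition spectrum (T : X -> X) (z : C) : Prop := ~ invertible (shift T z).

Definition quasinilpotent (T : X -> X) : Prop :=
  is_linear T /\ forall z : C, spectrum T z <-> z = RtoC 0.

Definition generalized_Drazin_inverse (T S : X -> X) : Prop :=
  is_linear S /\
  (forall x, S (T x) = T (S x)) /\
  (forall x, S (T (S x)) = S x) /\
  exists U : X -> X, quasinilpotent U /\
    forall x, T (S (T x)) = plus (T x) (U x).

Definition local_resolvent_set (T : X -> X) (x : X) (z : C) : Prop :=
  exists U : C -> Prop, open U /\ U z /\
    exists f : C -> X, analytic_on U f /\
      forall w : C, U w -> shift T w (f w) = x.

Definition local_spectrum (T : X -> X) (x : X) (z : C) : Prop :=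
  ~ local_resolvent_set T x z.

Definition local_spectral_subspace (T : X -> X) (Omega : C -> Prop) (x : X)
  : Prop := forall z : C, local_spectrum T x z -> Omega z.

Definition property_delta (T : X -> X) : Prop :=
  forall U V : C -> Prop, open U -> open V -> (forall z, U z \/ V z) ->
    forall x : X, exists u v : X,
      local_spectral_subspace T (closure U) u /\
      local_spectral_subspace T (closure V) v /\
      x = plus u v.

Definition property_beta (T : X -> X) : Prop :=
  forall U : C -> Prop, open U ->
  forall f : nat -> C -> X, (forall n, analytic_on U (f n)) ->
    (forall K : C -> Prop, compact_set K -> (forall z, K z -> U z) ->
       uniform_null_on K (fun n z => shift T z (f n z))) ->
    forall K : C -> Prop, compact_set K -> (forall z, K z -> U z) ->
      uniform_null_on K f.

Definition decomposable (T : X -> X) : Prop :=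
  property_beta T /\ property_delta T.

End Operators.

Arguments analytic_on {X}.
Arguments uniform_null_on {X}.
Arguments shift {X}.
Arguments invertible {X}.
Arguments spectrum {X}.
Arguments quasinilpotent {X}.
Arguments generalized_Drazin_inverse {X}.
Arguments local_resolvent_set {X}.
Arguments local_spectrum {X}.
Arguments local_spectral_subspace {X}.
Arguments property_delta {X}.
Arguments property_beta {X}.
Arguments decomposable {X}.

(* Main.v *)
Require Import Defs.
From Stdlib Require Import Reals.
From Coquelicot Require Import Coquelicot.
From Stdlib Require Import List Lra Lia Classical ClassicalEpsilon.

(** Write S for the generalized Drazin inverse and P for T S.  Since S T = T S
    and S T S = S, the operator P is an idempotent commuting with T and S; on
    its range T and S are inverse to each other, and on its kernel S is zero.

    On the range of P, (z - S) T = - z (1/z - T).  Hence a local resolvent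
    function f of T at 1/z gives the local resolvent function
    - T P ((1/z) f (1/z)) of S at z ([local_resolvent_inverse]), while near 0
    both operators have a resolvent on that range, a Neumann series in the other
    operator ([local_resolvent_near_zero]).  Property (delta) follows: an open
    cover {U, V} is transported by z -> 1/z, a small disc around 0 is adjoined
    to both sets to cover 0, and x = u + v is decomposed with respect to T.  The
    disc does no harm to P u and P v, whose local spectra for T avoid it, so
    these have local spectra for S in the closures of U and V.  The vector
    x - P x lies in the kernel of S and its local spectrum is contained in {0};
    it is added to the component belonging to a set that contains 0.

    For property (beta) let h_n = (z - S) f_n tend to 0.  On the kernel,
    z (f_n - P f_n) = h_n - P h_n.  On the range, away from 0, the functions
    g_n (m) = (1/m) P f_n (1/m) satisfy (m - T) g_n (m) = - T P h_n (1/m), so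
    property (beta) of T applies to them; near 0 the equation for P f_n can be
    solved with a uniform bound.  Together z f_n tends to 0, and the maximum
    principle removes the factor z ([locally_uniformly_null_quotient]).

    Analytic functions are given by local power series, and the argument needs
    them to be stable under z -> 1/z and under Neumann series, and to obey the
    maximum principle.  The first two come from one device that avoids
    rearranging double series: f is analytic at z0 exactly when every f (z0 + h)
    is the head of a geometrically bounded sequence y such that
    y_j - h y_(j+1) = a_j does not depend on h; the y_j are the successive
    remainders of the series ([analytic_on_remainders],
    [analytic_on_of_remainders]).  Three steps of the same recurrence give an
    approximate mean value property over the four points z0 + i^k t with error
    of order t^4, which is enough to exclude interior maxima of
    |f z| + eps |z|^2. *)

Open Scope R_scope.

Local Notation "c *: x" := (@scal C_AbsRing _ c x)
  (at level 40, left associativity).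
Local Notation "h ^^ n" := (@pow_n C_AbsRing h n)
  (at level 30, right associativity).

(** * Identities between linear combinations of vectors *)

(** Vectors are reified over a list of atoms, so that an identity between
    linear combinations reduces to identities in C between the coefficients. *)
Section Combinations.

Variable V : ModuleSpace C_AbsRing.

Inductive expr : Type :=
  | Atom : nat -> expr
  | Zero : expr
  | Plus : expr -> expr -> expr
  | Opp : expr -> expr
  | Scal : C -> expr -> expr.

Fixpoint eval (env : list V) (e : expr) : V :=
  match e with
  | Atom i => nth i env zero
  | Zero => zero
  | Plus e1 e2 => plus (eval env e1) (eval env e2)
  | Opp e1 => opp (eval env e1)
  | Scal c e1 => c *: (eval env e1)
  end.

Fixpoint coef (e : expr) (i : nat) : C :=
  match e with
  | Atom j => if Nat.eqb i j then RtoC 1 else RtoC 0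
  | Zero => RtoC 0
  | Plus e1 e2 => (coef e1 i + coef e2 i)%C
  | Opp e1 => (- coef e1 i)%C
  | Scal c e1 => (c * coef e1 i)%C
  end.

Fixpoint combination (env : list V) (g : nat -> C) : V :=
  match env with
  | nil => zero
  | x :: env' =>
      plus ((g 0%nat) *: x) (combination env' (fun i => g (S i)))
  end.

Fixpoint agree (n : nat) (g h : nat -> C) : Prop :=
  match n with
  | O => True
  | S n' => g 0%nat = h 0%nat /\ agree n' (fun i => g (S i)) (fun i => h (S i))
  end.

Lemma combination_ext env g h :
  agree (length env) g h -> combination env g = combination env h.
Proof.
  revert g h; induction env as [|x env IH]; intros g h; [easy|].
  intros [E A]; cbn [combination]. now rewrite E, (IH _ _ A).
Qed.

Lemma agree_refl n g h : (forall i, g i = h i) -> agree n g h.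
Proof.
  revert g h; induction n as [|n IH]; intros g h E; [exact I|].
  split; [apply E|]. apply IH; intros i; apply E.
Qed.

Lemma combination_zero env : combination env (fun _ => RtoC 0) = zero.
Proof.
  induction env as [|x env IH]; [easy|]; cbn [combination].
  rewrite IH, plus_zero_r. exact (scal_zero_l x).
Qed.

Lemma combination_plus env g h :
  combination env (fun i => (g i + h i)%C)
  = plus (combination env g) (combination env h).
Proof.
  revert g h; induction env as [|x env IH]; intros g h; cbn [combination].
  - now rewrite plus_zero_r.
  - rewrite (IH (fun i => g (S i)) (fun i => h (S i))).
    assert (D : (g 0%nat + h 0%nat)%C *: x
                = plus ((g 0%nat) *: x) ((h 0%nat) *: x))
      by apply (scal_distr_r (g 0%nat : C_AbsRing) (h 0%nat) x).
    rewrite D.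
    rewrite <- !plus_assoc; f_equal.
    rewrite !plus_assoc; f_equal. apply plus_comm.
Qed.

Lemma combination_scal env c g :
  combination env (fun i => (c * g i)%C)
  = c *: (combination env g).
Proof.
  revert g; induction env as [|x env IH]; intros g; cbn [combination].
  - symmetry; apply (scal_zero_r (c : C_AbsRing)).
  - rewrite (IH (fun i => g (S i))), scal_distr_l, scal_assoc.
    reflexivity.
Qed.

Lemma eval_combination env e : eval env e = combination env (coef e).
Proof.
  induction e as [j| |e1 IH1 e2 IH2|e IH|c e IH]; cbn [eval coef].
  - revert j; induction env as [|x env IH]; intros [|j]; cbn [nth combination].
    + reflexivity.
    + reflexivity.
    + cbn [Nat.eqb]. rewrite (combination_zero env), plus_zero_r.
      symmetry; apply (scal_one x).
    + cbn [Nat.eqb]. rewrite IH.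
      rewrite (scal_zero_l x : RtoC 0 *: x = zero).
      now rewrite plus_zero_l.
  - symmetry; apply combination_zero.
  - now rewrite combination_plus, IH1, IH2.
  - rewrite IH, <- (scal_opp_one (combination env (coef e))). symmetry.
    transitivity (combination env (fun i => (RtoC (-1) * coef e i)%C)).
    + apply combination_ext, agree_refl; intros i. ring.
    + rewrite combination_scal; f_equal.
      apply injective_projections; simpl; lra.
  - now rewrite combination_scal, IH.
Qed.

Lemma eval_eq env e1 e2 :
  agree (length env) (coef e1) (coef e2) -> eval env e1 = eval env e2.
Proof. rewrite !eval_combination; apply combination_ext. Qed.

End Combinations.

Arguments eval {V}.
Arguments combination {V}.

(** The match on a dummy term lets the comparison backtrack inside a tactic that
    returns a term. *)
Ltac position x l :=
  lazymatch l with
  | ?y :: ?l' =>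
      match constr:(Set) with
      | _ => let _ := match constr:(Set) with _ => constr_eq x y end in constr:(O)
      | _ => let n := position x l' in constr:(S n)
      end
  end.

Ltac adjoin x l :=
  match constr:(Set) with
  | _ => let _ := position x l in l
  | _ => constr:(x :: l)
  end.

Ltac atoms l t :=
  lazymatch t with
  | plus ?a ?b => let l' := atoms l a in atoms l' b
  | minus ?a ?b => let l' := atoms l a in atoms l' b
  | opp ?a => atoms l a
  | scal _ ?a => atoms l a
  | zero => l
  | _ => adjoin t l
  end.

Ltac reify l t :=
  lazymatch t with
  | plus ?a ?b => let a' := reify l a in let b' := reify l b in constr:(Plus a' b')
  | minus ?a ?b =>
      let a' := reify l a in let b' := reify l b in constr:(Plus a' (Opp b'))
  | opp ?a => let a' := reify l a in constr:(Opp a')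
  | scal ?c ?a => let a' := reify l a in constr:(Scal c a')
  | zero => constr:(Zero)
  | _ => let n := position t l in constr:(Atom n)
  end.

Ltac compare_coefficients V :=
  lazymatch goal with
  | |- ?u = ?v =>
      let l := atoms (@nil (ModuleSpace.sort C_AbsRing V)) u in
      let l := atoms l v in
      let e1 := reify l u in
      let e2 := reify l v in
      change (eval (V:=V) l e1 = eval (V:=V) l e2);
      apply eval_eq; cbn [length agree coef Nat.eqb];
      repeat match goal with |- _ /\ _ => split | |- True => exact I end
  end.

Ltac vring V := compare_coefficients V; ring.
Ltac vfield V := compare_coefficients V; field.

(** * Series in Banach spaces and their remainders *)

Section Series.

Variable X : CompleteNormedModule C_AbsRing.

Lemma norm_scal_le (c : C) (x : X) :
  norm (c *: x) <= Cmod c * norm x.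
Proof. exact (norm_scal (K := C_AbsRing) c x). Qed.

Lemma norm_pos (x : X) : 0 <= norm x.
Proof. exact (@norm_ge_0 _ X x). Qed.

Lemma norm_plus_le (x y : X) : norm (plus x y) <= norm x + norm y.
Proof. exact (@norm_triangle _ X x y). Qed.

Lemma norm_le_plus (z x y : X) : z = plus x y -> norm z <= norm x + norm y.
Proof. intros ->; apply norm_plus_le. Qed.

Lemma norm_opp_eq (x : X) : norm (opp x) = norm x.
Proof. exact (@norm_opp _ X x). Qed.

Lemma norm_minus_le (x y : X) : norm (minus x y) <= norm x + norm y.
Proof.
  rewrite <- (norm_opp_eq y). exact (norm_plus_le x (opp y)).
Qed.

(** These restate linearity over the structure inferred from X, the form in
    which it occurs in goals, so that it can be used for rewriting. *)
Lemma map_plus (L : X -> X) (x y : X) :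
  is_linear L -> L (plus x y) = plus (L x) (L y).
Proof. intros HL; exact (linear_plus L HL x y). Qed.

Lemma map_scal (L : X -> X) (c : C) (x : X) :
  is_linear L -> L (c *: x) = c *: L x.
Proof. intros HL; exact (linear_scal L HL (c : C_AbsRing) x). Qed.

Lemma map_minus (L : X -> X) (x y : X) :
  is_linear L -> L (minus x y) = minus (L x) (L y).
Proof. intros HL; exact (linear_minus L x y HL). Qed.

Lemma Cmod_pow_n (h : C) (n : nat) : Cmod (h ^^ n) = Cmod h ^ n.
Proof.
  induction n as [|n IH]; cbn [pow_n pow].
  - exact Cmod_1.
  - rewrite <- IH. exact (Cmod_mult h (h ^^ n)).
Qed.

Lemma is_series_norm (a : nat -> X) (l : X) :
  is_series a l <->
  forall eps : R, 0 < eps ->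
    exists N, forall n, (N <= n)%nat -> norm (minus l (sum_n a n)) < eps.
Proof.
  assert (S : forall n, norm (minus l (sum_n a n)) = norm (minus (sum_n a n) l)).
  { intros n. rewrite <- norm_opp_eq. f_equal. vring X. }
  split.
  - intros H eps he.
    destruct (H (fun y => norm (minus y l) < eps)) as [N HN].
    { apply (locally_le_locally_norm l). now exists (mkposreal eps he). }
    exists N; intros n hn. rewrite S. exact (HN n hn).
  - intros H P HP. apply (locally_norm_le_locally l) in HP.
    destruct HP as [eps HP].
    destruct (H eps (cond_pos eps)) as [N HN].
    exists N; intros n hn. apply HP. unfold ball_norm.
    rewrite <- S. now apply HN.
Qed.

Lemma pow_small (q M eps : R) :
  0 <= q < 1 -> 0 < eps -> exists N, forall n, (N <= n)%nat -> M * q ^ n < eps.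
Proof.
  intros hq he.
  destruct (pow_lt_1_zero q) with (y := eps / (Rabs M + 1)) as [N HN].
  - rewrite Rabs_right; lra.
  - apply Rdiv_lt_0_compat; [easy|]. pose proof (Rabs_pos M); lra.
  - exists N; intros n hn. specialize (HN n hn).
    rewrite Rabs_right in HN by (apply Rle_ge, pow_le; lra).
    pose proof (Rabs_pos M). pose proof (Rle_abs M).
    pose proof (pow_le q n (proj1 hq)).
    apply Rle_lt_trans with ((Rabs M + 1) * q ^ n); [nra|].
    apply Rlt_le_trans with ((Rabs M + 1) * (eps / (Rabs M + 1))).
    + apply Rmult_lt_compat_l; lra.
    + right; field; lra.
Qed.

Lemma is_series_unique_limit (a : nat -> X) (l l' : X) :
  is_series a l -> is_series a l' -> l = l'.
Proof.
  rewrite !is_series_norm; intros H H'.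
  apply NNPP; intros D.
  assert (0 < norm (minus l l')) as hp.
  { destruct (norm_pos (minus l l')) as [|E]; [easy|]. exfalso; apply D.
    symmetry in E; apply norm_eq_zero in E.
    transitivity (plus (minus l l') l'); [vring X|].
    rewrite E. apply plus_zero_l. }
  destruct (H (norm (minus l l') / 2)) as [N HN]; [lra|].
  destruct (H' (norm (minus l l') / 2)) as [N' HN']; [lra|].
  specialize (HN (N + N')%nat ltac:(lia)). specialize (HN' (N + N')%nat ltac:(lia)).
  pose proof (norm_minus_le (minus l (sum_n a (N + N')))
                            (minus l' (sum_n a (N + N')))) as T.
  replace (minus (minus l (sum_n a (N + N'))) (minus l' (sum_n a (N + N'))))
    with (minus l l') in T by vring X.
  lra.
Qed.

Lemma geometric_series (a : nat -> X) (M q : R) :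
  0 <= q < 1 -> (forall n, norm (a n) <= M * q ^ n) ->
  exists l, is_series a l /\ norm l <= M / (1 - q).
Proof.
  intros hq ha.
  destruct (ex_series_le a (fun n => M * q ^ n) ha) as [l Hl].
  { apply (ex_series_scal_l (K := R_AbsRing) M (fun n => q ^ n)).
    apply ex_series_geom. rewrite Rabs_right; lra. }
  exists l; split; [exact Hl|].
  assert (hM : 0 <= M).
  { specialize (ha 0%nat). pose proof (norm_pos (a 0%nat)). simpl in ha; lra. }
  assert (B : forall n, norm (sum_n a n) <= M / (1 - q) * (1 - q ^ S n)).
  { induction n as [|n IH].
    - rewrite sum_O. eapply Rle_trans; [apply ha|]. right; simpl; field; lra.
    - rewrite sum_Sn. eapply Rle_trans; [apply norm_plus_le|].
      eapply Rle_trans; [apply Rplus_le_compat; [apply IH|apply ha]|].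
      right; simpl; field; lra. }
  apply le_epsilon; intros eps he.
  destruct (proj1 (is_series_norm a l) Hl eps he) as [N HN].
  specialize (HN N (le_n N)). specialize (B N).
  assert (M / (1 - q) * (1 - q ^ S N) <= M / (1 - q)).
  { assert (0 <= M / (1 - q)).
    { apply Rmult_le_pos; [lra|]. left; apply Rinv_0_lt_compat; lra. }
    pose proof (pow_le q (S N) (proj1 hq)). nra. }
  replace l with (plus (minus l (sum_n a N)) (sum_n a N)) by vring X.
  eapply Rle_trans; [apply norm_plus_le|].
  rewrite (Rplus_comm _ eps).
  apply Rplus_le_compat; [left; exact HN|exact (Rle_trans _ _ _ B H)].
Qed.

(** Telescoping: y_0 minus the n-th partial sum is h^(n+1) y_(n+1), which is
    geometrically small. *)
Lemma pseries_of_remainders (d y : nat -> X) (h : C) (M rate : R) :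
  (forall j, y j = plus (d j) (h *: y (S j))) ->
  (forall j, norm (y j) <= M * rate ^ j) -> 0 <= rate -> Cmod h * rate < 1 ->
  is_pseries (K := C_AbsRing) d h (y 0%nat).
Proof.
  intros rec bound hR small. apply is_series_norm; intros eps he.
  assert (E : forall n,
    minus (y 0%nat) (sum_n (fun k => h ^^ k *: d k) n)
    = h ^^ (S n) *: y (S n)).
  { induction n as [|n IH].
    - rewrite sum_O, (rec 0%nat). cbn [pow_n].
      change (@one C_AbsRing) with (RtoC 1).
      change (@mult C_AbsRing) with Cmult. vring X.
    - rewrite sum_Sn.
      transitivity (minus
        (minus (y 0%nat) (sum_n (fun k => h ^^ k *: d k) n))
        (h ^^ (S n) *: d (S n))); [vring X|].
      rewrite IH, (rec (S n)). cbn [pow_n].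
      change (@mult C_AbsRing) with Cmult. vring X. }
  pose proof (Cmod_ge_0 h) as hh.
  assert (hq : 0 <= Cmod h * rate < 1) by (split; [now apply Rmult_le_pos|easy]).
  destruct (pow_small (Cmod h * rate) M eps hq he) as [N HN].
  exists N; intros n hn. rewrite E.
  eapply Rle_lt_trans; [apply norm_scal_le|].
  rewrite Cmod_pow_n.
  apply Rle_lt_trans with (M * (Cmod h * rate) ^ S n); [|apply HN; lia].
  rewrite Rpow_mult_distr, (Rmult_comm M), Rmult_assoc, (Rmult_comm _ M).
  apply Rmult_le_compat_l; [now apply pow_le|apply bound].
Qed.

(** The remainders y_j are the sums of the shifted series of general term
    h^n d_(n+j).  The bound 1/2 on the ratio is what gives the factor 2. *)
Lemma remainders_exist (d : nat -> X) (h : C) (M rate : R) :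
  (forall j, norm (d j) <= M * rate ^ j) -> 0 <= rate -> Cmod h * rate <= 1 / 2 ->
  exists y : nat -> X,
    (forall j, y j = plus (d j) (h *: y (S j))) /\
    (forall j, norm (y j) <= 2 * M * rate ^ j).
Proof.
  intros hd hR small. pose proof (Cmod_ge_0 h) as hh.
  assert (hq : 0 <= Cmod h * rate < 1) by (split; [now apply Rmult_le_pos|lra]).
  (* The ratio |h| rate is at most 1/2, so the geometric bound at most doubles. *)
  assert (L : forall j, exists l,
    is_series (fun n => h ^^ n *: d (n + j)%nat) l /\
    norm l <= 2 * M * rate ^ j).
  { intros j.
    destruct (geometric_series
      (fun n => h ^^ n *: d (n + j)%nat)
      (M * rate ^ j) (Cmod h * rate) hq) as [l [Hl Bl]].
    - intros n. eapply Rle_trans; [apply norm_scal_le|]. rewrite Cmod_pow_n.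
      apply Rle_trans with (Cmod h ^ n * (M * rate ^ (n + j))).
      + apply Rmult_le_compat_l; [now apply pow_le|apply hd].
      + rewrite Rpow_mult_distr, pow_add. right; ring.
    - exists l; split; [exact Hl|]. eapply Rle_trans; [exact Bl|].
      assert (0 <= M * rate ^ j) by (eapply Rle_trans; [apply norm_pos|apply hd]).
      apply Rle_trans with (M * rate ^ j / (1 / 2)); [|right; field].
      apply Rmult_le_compat_l; [easy|]. apply Rinv_le_contravar; lra. }
  destruct (choice _ L) as [y Hy]. exists y; split; [|intros j; apply Hy].
  intros j. destruct (Hy j) as [H _]. destruct (Hy (S j)) as [H' _].
  refine (is_series_unique_limit _ _ _ H _).
  pose proof (is_series_scal_l (K := C_AbsRing) h _ _ H') as Q.
  apply is_series_decr_1.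
  replace (h *: y (S j))
    with (plus (plus (d j) (h *: y (S j)))
               (opp (h ^^ 0 *: d (0 + j)%nat))) in Q.
  - refine (is_series_ext _ _ _ _ Q). intros n; cbn [pow_n].
    replace (n + S j)%nat with (S n + j)%nat by lia.
    change (@mult C_AbsRing) with Cmult. vring X.
  - cbn [pow_n Nat.add]. change (@one C_AbsRing) with (RtoC 1). vring X.
Qed.

End Series.

(** * Analytic functions and Neumann series *)

Section Analytic.

Variable X : CompleteNormedModule C_AbsRing.

Lemma is_series_linear (L : X -> X) (a : nat -> X) (l : X) :
  is_linear L -> is_series a l -> is_series (fun n => L (a n)) (L l).
Proof.
  intros HL Hl. destruct (linear_norm L HL) as (c & hc & bL).
  apply is_series_norm; intros eps he.
  destruct (proj1 (is_series_norm _ _ _) Hl (eps / c)) as [N HN].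
  { now apply Rdiv_lt_0_compat. }
  exists N; intros n hn. specialize (HN n hn).
  replace (sum_n (fun n => L (a n)) n) with (L (sum_n a n)).
  - rewrite <- (map_minus _ L _ _ HL).
    eapply Rle_lt_trans; [apply bL|].
    replace eps with (c * (eps / c)) by (field; lra).
    now apply Rmult_lt_compat_l.
  - clear - HL. induction n as [|n IH]; [now rewrite !sum_O|].
    rewrite !sum_Sn, <- IH. apply (map_plus _ L _ _ HL).
Qed.

Lemma pseries_coefficient_bound (a : nat -> X) (t : R) (l : X) :
  0 < t -> is_pseries (K := C_AbsRing) a (RtoC t) l ->
  exists M, forall j, norm (a j) <= M * (/ t) ^ j.
Proof.
  intros ht H.
  destruct (filterlim_bounded _ (ex_intro _ l H)) as [M HM].
  exists (2 * M); intros j.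
  set (u := fun k => RtoC t ^^ k *: a k).
  assert (B : norm (u j) <= 2 * M).
  { destruct j as [|j].
    - pose proof (HM 0%nat) as H0. rewrite sum_O in H0.
      assert (0 <= M) by (eapply Rle_trans; [apply norm_pos|exact H0]).
      apply Rle_trans with M; [exact H0|lra].
    - replace (u (S j)) with (minus (sum_n u (S j)) (sum_n u j)).
      + eapply Rle_trans; [apply norm_minus_le|].
        replace (2 * M) with (M + M) by ring.
        apply Rplus_le_compat; apply HM.
      + rewrite sum_Sn. vring X. }
  assert (hc : RtoC t ^^ j <> RtoC 0).
  { apply Cmod_gt_0. rewrite Cmod_pow_n, Cmod_R, Rabs_right by lra.
    now apply pow_lt. }
  replace (a j) with ((/ RtoC t ^^ j)%C *: u j).
  - eapply Rle_trans; [apply norm_scal_le|].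
    rewrite Cmod_inv, Cmod_pow_n, Cmod_R, Rabs_right by (lra || assumption).
    rewrite pow_inv, (Rmult_comm (2 * M)).
    apply Rmult_le_compat_l; [|exact B].
    left; apply Rinv_0_lt_compat. now apply pow_lt.
  - unfold u. vfield X. exact hc.
Qed.

(** The radius is cut to a quarter, so that the bound M and the rate serve all
    h at once, as the estimates of mean value type require. *)
Lemma analytic_on_remainders (U : C -> Prop) (f : C -> X) (z0 : C) :
  analytic_on U f -> U z0 ->
  exists (a : nat -> X) (r M rate : R), 0 < r /\ 0 < rate /\
    forall h : C, Cmod h < r ->
      exists y : nat -> X, y 0%nat = f (z0 + h)%C /\
        (forall j, y j = plus (a j) (h *: y (S j))) /\
        (forall j, norm (y j) <= M * rate ^ j).
Proof.
  intros H h0. destruct (H z0 h0) as (a & r & hr & Hf).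
  assert (Hf' : forall h : C, Cmod h < r ->
    is_pseries (K := C_AbsRing) a h (f (z0 + h)%C)).
  { intros h hh. specialize (Hf (z0 + h)%C).
    replace (z0 + h - z0)%C with h in Hf by ring. now apply Hf. }
  destruct (pseries_coefficient_bound a (r / 2) (f (z0 + RtoC (r / 2))%C))
    as [M HM]; [lra| |].
  { apply Hf'. rewrite Cmod_R, Rabs_right; lra. }
  assert (hR : 0 < / (r / 2)) by (apply Rinv_0_lt_compat; lra).
  exists a, (r / 4), (2 * M), (/ (r / 2)); split; [lra|split; [exact hR|]].
  intros h hh.
  assert (small : Cmod h * / (r / 2) <= 1 / 2).
  { apply Rle_trans with (r / 4 * / (r / 2)).
    - apply Rmult_le_compat_r; lra.
    - right; field; lra. }
  destruct (remainders_exist _ a h M (/ (r / 2)) HM) as (y & rec & bound);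
    [lra|exact small|].
  exists y; split; [|now split].
  refine (is_series_unique_limit _ _ _ _
    (pseries_of_remainders _ a y h (2 * M) (/ (r / 2)) rec bound _ _) _);
    [lra|lra|].
  apply Hf'; lra.
Qed.

(** Here the bound M may depend on h, which spares every uniform estimate when
    a function is shown to be analytic. *)
Lemma analytic_on_of_remainders (U : C -> Prop) (f : C -> X) :
  (forall z0, U z0 -> exists (a : nat -> X) (r rate : R), 0 < r /\ 0 < rate /\
    forall h : C, Cmod h < r ->
      exists (y : nat -> X) (M : R), y 0%nat = f (z0 + h)%C /\
        (forall j, y j = plus (a j) (h *: y (S j))) /\
        (forall j, norm (y j) <= M * rate ^ j)) ->
  analytic_on U f.
Proof.
  intros H z0 h0. destruct (H z0 h0) as (a & r & rate & hr & hR & Hf).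
  exists a, (Rmin r (/ rate)); split.
  - apply Rmin_pos; [easy|]. now apply Rinv_0_lt_compat.
  - intros z hz.
    destruct (Hf (z - z0)%C) as (y & M & y0 & rec & bound).
    { eapply Rlt_le_trans; [exact hz|apply Rmin_l]. }
    replace (z0 + (z - z0))%C with z in y0 by ring. rewrite <- y0.
    apply (pseries_of_remainders _ a y _ M rate rec bound); [lra|].
    replace 1 with (/ rate * rate) by (field; lra).
    apply Rmult_lt_compat_r; [easy|].
    eapply Rlt_le_trans; [exact hz|apply Rmin_r].
Qed.

Lemma analytic_on_subset (U V : C -> Prop) (f : C -> X) :
  (forall z, V z -> U z) -> analytic_on U f -> analytic_on V f.
Proof. intros S H z0 h0. exact (H z0 (S z0 h0)). Qed.

Lemma analytic_on_plus (U : C -> Prop) (f g : C -> X) :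
  analytic_on U f -> analytic_on U g ->
  analytic_on U (fun z => plus (f z) (g z)).
Proof.
  intros Hf Hg z0 h0.
  destruct (Hf z0 h0) as (a & r & hr & Ha). destruct (Hg z0 h0) as (b & s & hs & Hb).
  exists (PS_plus a b), (Rmin r s); split; [now apply Rmin_pos|].
  intros z hz. apply (is_pseries_plus a b).
  - apply Ha. eapply Rlt_le_trans; [exact hz|apply Rmin_l].
  - apply Hb. eapply Rlt_le_trans; [exact hz|apply Rmin_r].
Qed.

Lemma analytic_on_linear (U : C -> Prop) (f : C -> X) (L : X -> X) :
  is_linear L -> analytic_on U f -> analytic_on U (fun z => L (f z)).
Proof.
  intros HL Hf z0 h0. destruct (Hf z0 h0) as (a & r & hr & H).
  exists (fun j => L (a j)), r; split; [easy|]. intros z hz.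
  apply (is_series_ext
    (fun k => L ((z - z0)%C ^^ k *: a k))).
  - intros n; apply (map_scal _ L _ _ HL).
  - apply (is_series_linear L _ _ HL), H, hz.
Qed.

(** The equation u - w A u = x has a solution, the sum of the iterates of w A
    at x, and only one, because w A is a strict contraction.  Linearity, the
    bound and the second identity all follow from uniqueness. *)
Lemma neumann_inverse (A : X -> X) (beta : R) (w : C) :
  is_linear A -> 0 < beta -> (forall x, norm (A x) <= beta * norm x) ->
  Cmod w * beta < 1 ->
  exists G : X -> X, is_linear G /\
    (forall x, minus (G x) (w *: A (G x)) = x) /\
    (forall x, G (minus x (w *: A x)) = x).
Proof.
  intros HA hb bA small. pose proof (Cmod_ge_0 w) as hw.
  assert (hq : 0 <= Cmod w * beta < 1) by (split; [apply Rmult_le_pos; lra|easy]).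
  assert (contract : forall x, norm (w *: A x)
                               <= Cmod w * beta * norm x).
  { intros x. eapply Rle_trans; [apply norm_scal_le|]. rewrite Rmult_assoc.
    now apply Rmult_le_compat_l. }
  assert (injective : forall x y : X,
    minus x (w *: A x) = minus y (w *: A y) ->
    x = y).
  { intros x y E.
    assert (F : minus x y = w *: A (minus x y)).
    { rewrite (map_minus _ A x y HA).
      transitivity (plus (minus (minus x (w *: A x))
                                (minus y (w *: A y)))
                         (w *: (minus (A x) (A y)))); [vring X|].
      rewrite E. vring X. }
    pose proof (contract (minus x y)) as c. rewrite <- F in c.
    assert (Z : norm (minus x y) = 0).
    { pose proof (norm_pos _ (minus x y)). nra. }
    apply norm_eq_zero in Z.
    transitivity (plus (minus x y) y); [vring X|]. rewrite Z. vring X. }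
  assert (surjective : forall x : X, exists u : X,
    minus u (w *: A u) = x).
  { intros x. set (a := fun n => Nat.iter n (fun u => w *: A u) x).
    destruct (geometric_series _ a (norm x) (Cmod w * beta) hq) as [u [Hu _]].
    - induction n as [|n IH]; [simpl; lra|].
      cbn [a Nat.iter nat_rect]. eapply Rle_trans; [apply contract|].
      simpl pow. fold (a n).
      apply Rle_trans with (Cmod w * beta * (norm x * (Cmod w * beta) ^ n));
        [|right; ring].
      now apply Rmult_le_compat_l.
    - exists u.
      assert (Q : is_series (fun n => a (S n)) (w *: A u)).
      { apply (is_series_scal_l (K := C_AbsRing) w (fun n => A (a n))).
        now apply is_series_linear. }
      assert (Q' : is_series a (plus (w *: A u) x)).
      { apply is_series_decr_1.
        replace (w *: A u)
          with (plus (plus (w *: A u) x) (opp (a 0%nat))) in Q;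
          [exact Q|].
        cbn [a Nat.iter nat_rect]. vring X. }
      rewrite (is_series_unique_limit _ _ _ _ Hu Q') at 1. vring X. }
  destruct (choice _ surjective) as [G HG]. exists G.
  split; [|split; [exact HG|intros x; apply injective; apply HG]].
  split.
  - intros x y. apply injective. rewrite HG, (map_plus _ A _ _ HA).
    transitivity (plus (minus (G x) (w *: A (G x)))
                       (minus (G y) (w *: A (G y)))); [|vring X].
    now rewrite !HG.
  - intros k x. apply injective. rewrite HG, (map_scal _ A _ _ HA).
    transitivity (scal k (minus (G x) (w *: A (G x))));
      [|vring X].
    now rewrite HG.
  - exists (/ (1 - Cmod w * beta)); split; [apply Rinv_0_lt_compat; lra|].
    intros x.
    apply (Rmult_le_reg_l (1 - Cmod w * beta)); [lra|].
    rewrite <- Rmult_assoc, Rinv_r, Rmult_1_l by lra.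
    pose proof (contract (G x)) as c.
    assert (t : norm (G x) <= norm x + norm (w *: A (G x))).
    { apply norm_le_plus. rewrite <- (HG x) at 2. vring X. }
    lra.
Qed.

(** With G the inverse of 1 - w A, the solution at w + h satisfies
    f (w + h) = G v + h G A (f (w + h)).  Applying powers of G A gives a sequence
    of remainders around w, so no power series is re-expanded. *)
Lemma neumann_analytic (A : X -> X) (beta : R) (v : X) :
  is_linear A -> 0 < beta -> (forall x, norm (A x) <= beta * norm x) ->
  exists f : C -> X, analytic_on (fun z => Cmod z * beta < 1) f /\
    forall z, Cmod z * beta < 1 -> minus (f z) (z *: A (f z)) = v.
Proof.
  intros HA hb bA.
  assert (E : forall z : C, exists u : X,
    Cmod z * beta < 1 -> minus u (z *: A u) = v).
  { intros z. destruct (Rlt_dec (Cmod z * beta) 1) as [hz|hz].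
    - destruct (neumann_inverse A beta z HA hb bA hz) as (G & _ & HG & _).
      exists (G v); intros _; apply HG.
    - exists v; easy. }
  destruct (choice _ E) as [f Hf]. exists f; split; [|exact Hf].
  apply analytic_on_of_remainders. intros w hw.
  destruct (neumann_inverse A beta w HA hb bA hw) as (G & HG & _ & GI).
  assert (HB : is_linear (fun x => G (A x))) by now apply (is_linear_comp A G).
  set (B := fun x => G (A x)) in HB.
  destruct (linear_norm _ HB) as (g & hg & bB).
  exists (fun n => Nat.iter n B (G v)), ((1 - Cmod w * beta) / beta), g.
  split; [apply Rdiv_lt_0_compat; lra|split; [exact hg|]].
  intros h hh.
  assert (hz : Cmod (w + h)%C * beta < 1).
  { apply Rle_lt_trans with ((Cmod w + Cmod h) * beta).
    - apply Rmult_le_compat_r; [lra|apply Cmod_triangle].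
    - apply (Rmult_lt_compat_r beta) in hh; [|easy].
      replace ((1 - Cmod w * beta) / beta * beta) with (1 - Cmod w * beta) in hh
        by (field; lra).
      lra. }
  specialize (Hf _ hz). set (u := f (w + h)%C) in *.
  exists (fun n => Nat.iter n B u), (norm u); split; [reflexivity|split].
  - assert (step : u = plus (G v) (h *: B u)).
    { unfold B. rewrite <- (map_scal _ G _ _ HG), <- (map_plus _ G _ _ HG).
      rewrite <- (GI u) at 1. f_equal. rewrite <- Hf. vring X. }
    induction j as [|j IH]; [exact step|].
    cbn [Nat.iter nat_rect] in *. rewrite IH at 1.
    rewrite (map_plus _ B _ _ HB), (map_scal _ B _ _ HB). reflexivity.
  - induction j as [|j IH]; [simpl; lra|].
    cbn [Nat.iter nat_rect]. eapply Rle_trans; [apply bB|].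
    simpl pow. replace (norm u * (g * g ^ j)) with (g * (norm u * g ^ j)) by ring.
    apply Rmult_le_compat_l; [lra|exact IH].
Qed.

End Analytic.

Lemma Cmod_Ci : Cmod Ci = 1.
Proof.
  unfold Cmod, Ci; simpl. replace (0 * (0 * 1) + 1 * (1 * 1)) with 1 by ring.
  apply sqrt_1.
Qed.

(** * Inversion of the complex variable *)

Lemma Cminus_0_r (z : C) : (z - RtoC 0)%C = z.
Proof. ring. Qed.

Lemma Cinv_nonzero (z : C) : z <> RtoC 0 -> (/ z)%C <> RtoC 0.
Proof.
  intros hz. apply Cmod_gt_0. rewrite Cmod_inv by easy.
  apply Rinv_0_lt_compat. now apply Cmod_gt_0.
Qed.

Lemma Cinv_involutive (z : C) : z <> RtoC 0 -> (/ / z)%C = z.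
Proof. intros hz. field. exact hz. Qed.

Lemma locally_Cmod (z : C) (P : C -> Prop) :
  locally z P <-> exists d, 0 < d /\ forall w : C, Cmod (w - z)%C < d -> P w.
Proof.
  split.
  - intros [d Hd]. exists d; split; [apply cond_pos|]. intros w hw. apply Hd.
    pose proof (Rmax_Cmod (w - z)%C) as m.
    split.
    + apply (Rle_lt_trans _ _ _ (Rle_trans _ _ _ (Rmax_l _ _) m) hw).
    + apply (Rle_lt_trans _ _ _ (Rle_trans _ _ _ (Rmax_r _ _) m) hw).
  - intros (d & hd & Hd). apply locally_C.
    exists (mkposreal d hd). exact Hd.
Qed.

Lemma open_disc (z : C) (d : R) : open (fun w : C => Cmod (w - z)%C < d).
Proof.
  intros w hw. apply locally_Cmod. exists (d - Cmod (w - z)%C); split; [lra|].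
  intros v hv. replace (v - z)%C with ((v - w) + (w - z))%C by ring.
  pose proof (Cmod_triangle (v - w) (w - z)). lra.
Qed.

Lemma open_or (U V : C -> Prop) : open U -> open V -> open (fun z => U z \/ V z).
Proof.
  intros HU HV z [h|h].
  - apply (filter_imp U); [now left|now apply HU].
  - apply (filter_imp V); [now right|now apply HV].
Qed.

Lemma inverse_difference (m k : C) :
  m <> RtoC 0 -> Cmod k < Cmod m / 2 ->
  (m + k)%C <> RtoC 0 /\ Cmod (/ (m + k) - / m)%C <= 2 * Cmod k / Cmod m ^ 2.
Proof.
  intros hm hk. pose proof (proj1 (Cmod_gt_0 m) hm) as pm.
  pose proof (Cmod_ge_0 k) as pk.
  assert (low : Cmod m / 2 <= Cmod (m + k)).
  { pose proof (Cmod_triangle (m + k) (- k)) as t.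
    replace (m + k + - k)%C with m in t by ring. rewrite Cmod_opp in t. lra. }
  assert (hz : (m + k)%C <> RtoC 0) by (apply Cmod_gt_0; lra).
  split; [easy|].
  replace (/ (m + k) - / m)%C with (- k * (/ (m + k) * / m))%C by (field; now split).
  rewrite !Cmod_mult, Cmod_opp, !Cmod_inv by assumption.
  replace (2 * Cmod k / Cmod m ^ 2) with (Cmod k * (/ (Cmod m / 2) * / Cmod m))
    by (field; lra).
  apply Rmult_le_compat_l; [easy|].
  apply Rmult_le_compat_r; [left; now apply Rinv_0_lt_compat|].
  apply Rinv_le_contravar; lra.
Qed.

(** Continuity of the inverse, in the form needed to pull back open sets. *)
Lemma locally_inverse (z : C) (P : C -> Prop) :
  z <> RtoC 0 -> locally (/ z)%C P ->
  locally z (fun w : C => w <> RtoC 0 /\ P (/ w)%C).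
Proof.
  intros hz H. apply locally_Cmod in H; destruct H as (d & hd & Hd).
  pose proof (proj1 (Cmod_gt_0 z) hz) as pz.
  apply locally_Cmod.
  exists (Rmin (Cmod z / 2) (d * Cmod z ^ 2 / 2)); split.
  - apply Rmin_pos; [lra|]. pose proof (pow_lt _ 2 pz). nra.
  - intros w hw.
    destruct (inverse_difference z (w - z) hz) as [nz dist].
    { eapply Rlt_le_trans; [exact hw|apply Rmin_l]. }
    replace (z + (w - z))%C with w in * by ring.
    split; [easy|]. apply Hd. eapply Rle_lt_trans; [exact dist|].
    apply (Rmult_lt_reg_r (Cmod z ^ 2 / 2)).
    + pose proof (pow_lt _ 2 pz). lra.
    + replace (2 * Cmod (w - z) / Cmod z ^ 2 * (Cmod z ^ 2 / 2))
        with (Cmod (w - z)) by (field; lra).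
      eapply Rlt_le_trans; [exact hw|]. eapply Rle_trans; [apply Rmin_r|].
      right; field.
Qed.

Lemma open_inverse (U : C -> Prop) :
  open U -> open (fun z : C => z <> RtoC 0 /\ U (/ z)%C).
Proof. intros HU z [hz h]. apply locally_inverse; [easy|]. now apply HU. Qed.

(** * Analyticity under inversion and upper bounds for the norm *)

Section Inversion.

Variable X : CompleteNormedModule C_AbsRing.

(** For a shift operator s on sequences this is - (m + s) / m^2.  Put
    h = 1/(m+k) - 1/m.  Then (1 + k/m) (1 - h s) = 1 - k inversion_step m, which
    converts remainders in h around 1/m into remainders in k around m. *)
Definition inversion_step (m : C) (b : nat -> X) : nat -> X :=
  fun j => plus ((- / m)%C *: b j) ((- / (m * m))%C *: b (S j)).

(** The factor 1/z absorbs the factor 1 + k/m that appears when the recurrence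
    around 1/m is rewritten around m: if (1 - h s) y = a, then
    (1 - k inversion_step m) (y / (m+k)) = a / m.  Iterating inversion_step m
    gives the remainders at m. *)
Lemma analytic_on_inverse (U : C -> Prop) (f : C -> X) :
  analytic_on U f ->
  analytic_on (fun z => z <> RtoC 0 /\ U (/ z)%C) (fun z => (/ z)%C *: f (/ z)%C).
Proof.
  intros Hf. apply analytic_on_of_remainders. intros m [hm hU].
  destruct (analytic_on_remainders _ U f _ Hf hU)
    as (a & r & M & rate & hr & hR & H).
  pose proof (proj1 (Cmod_gt_0 m) hm) as pm.
  set (B := inversion_step m).
  set (beta := / Cmod m + / (Cmod m * Cmod m) * rate).
  exists (fun n => Nat.iter n B (fun j => (/ m)%C *: a j) 0%nat),
         (Rmin (Cmod m / 2) (r * Cmod m ^ 2 / 2)), beta.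
  assert (i1 : 0 < / Cmod m) by now apply Rinv_0_lt_compat.
  assert (i2 : 0 < / (Cmod m * Cmod m)) by (apply Rinv_0_lt_compat; nra).
  split; [|split; [unfold beta; nra|]].
  { apply Rmin_pos; [lra|]. pose proof (pow_lt _ 2 pm). nra. }
  intros k hk.
  destruct (inverse_difference m k hm) as [hz dist].
  { eapply Rlt_le_trans; [exact hk|apply Rmin_l]. }
  destruct (H (/ (m + k) - / m)%C) as (y & y0 & rec & bound).
  { eapply Rle_lt_trans; [exact dist|].
    apply (Rmult_lt_reg_r (Cmod m ^ 2 / 2)).
    - pose proof (pow_lt _ 2 pm). lra.
    - replace (2 * Cmod k / Cmod m ^ 2 * (Cmod m ^ 2 / 2))
        with (Cmod k) by (field; lra).
      eapply Rlt_le_trans; [exact hk|]. eapply Rle_trans; [apply Rmin_r|].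
      right; field. }
  replace (/ m + (/ (m + k) - / m))%C with (/ (m + k))%C in y0 by ring.
  set (Y := fun n => Nat.iter n B (fun j => (/ (m + k))%C *: y j)).
  set (d := fun n => Nat.iter n B (fun j => (/ m)%C *: a j)).
  assert (recY : forall n j, Y n j = plus (d n j) (k *: Y (S n) j)).
  { induction n as [|n IH]; intros j.
    - cbn [Y d Nat.iter nat_rect]. unfold B, inversion_step. rewrite (rec j).
      vfield X; now repeat split.
    - change (inversion_step m (Y n) j
              = plus (inversion_step m (d n) j) (k *: inversion_step m (Y (S n)) j)).
      unfold inversion_step. rewrite (IH j), (IH (S j)). vring X. }
  exists (fun n => Y n 0%nat), (/ Cmod (m + k) * M); split; [|split].
  - cbn [Y Nat.iter nat_rect]. now rewrite y0.
  - intros n. apply recY.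
  - assert (bY : forall n j,
      norm (Y n j) <= / Cmod (m + k) * M * beta ^ n * rate ^ j).
    { induction n as [|n IH]; intros j.
      - cbn [Y Nat.iter nat_rect]. eapply Rle_trans; [apply norm_scal_le|].
        rewrite Cmod_inv by easy. simpl pow. rewrite Rmult_1_r, Rmult_assoc.
        apply Rmult_le_compat_l; [|apply bound].
        left; apply Rinv_0_lt_compat. now apply Cmod_gt_0.
      - change (Y (S n) j) with (inversion_step m (Y n) j). unfold inversion_step.
        eapply Rle_trans; [apply norm_plus_le|].
        apply Rle_trans with
          (/ Cmod m * (/ Cmod (m + k) * M * beta ^ n * rate ^ j)
           + / (Cmod m * Cmod m) * (/ Cmod (m + k) * M * beta ^ n * rate ^ S j)).
        + apply Rplus_le_compat; (eapply Rle_trans; [apply norm_scal_le|]);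
            rewrite Cmod_opp, Cmod_inv, ?Cmod_mult.
          * apply Rmult_le_compat_l; [lra|apply IH].
          * easy.
          * apply Rmult_le_compat_l; [lra|apply IH].
          * now apply Cmult_neq_0.
        + rewrite <- (tech_pow_Rmult beta n), <- (tech_pow_Rmult rate j).
          generalize (beta ^ n); intros b. right. unfold beta. ring. }
    intros n. specialize (bY n 0%nat). simpl pow in bY. now rewrite Rmult_1_r in bY.
Qed.

Lemma analytic_norm_upper_semicontinuous (U : C -> Prop) (f : C -> X)
  (z : C) (e : R) :
  analytic_on U f -> U z -> 0 < e ->
  locally z (fun w => norm (f w) < norm (f z) + e).
Proof.
  intros Hf hz he.
  destruct (analytic_on_remainders _ U f z Hf hz)
    as (a & r & M & rate & hr & hR & H).
  assert (fz : f z = a 0%nat).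
  { destruct (H (RtoC 0)) as (y & y0 & rec & _); [now rewrite Cmod_0|].
    replace (z + RtoC 0)%C with z in y0 by ring.
    rewrite <- y0, (rec 0%nat). vring X. }
  apply locally_Cmod.
  assert (pM : 0 < Rabs (M * rate) + 1) by (pose proof (Rabs_pos (M * rate)); lra).
  exists (Rmin r (e / (Rabs (M * rate) + 1))); split.
  - apply Rmin_pos; [easy|]. now apply Rdiv_lt_0_compat.
  - intros w hw. destruct (H (w - z)%C) as (y & y0 & rec & bound).
    { eapply Rlt_le_trans; [exact hw|apply Rmin_l]. }
    replace (z + (w - z))%C with w in y0 by ring.
    rewrite <- y0, (rec 0%nat), fz.
    eapply Rle_lt_trans; [apply norm_plus_le|]. apply Rplus_lt_compat_l.
    eapply Rle_lt_trans; [apply norm_scal_le|].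
    specialize (bound 1%nat). simpl pow in bound. rewrite Rmult_1_r in bound.
    pose proof (Cmod_ge_0 (w - z)%C). pose proof (Rle_abs (M * rate)).
    apply Rle_lt_trans with (Cmod (w - z)%C * (Rabs (M * rate) + 1)).
    + apply Rmult_le_compat_l; lra.
    + replace e with (e / (Rabs (M * rate) + 1) * (Rabs (M * rate) + 1)) by (field; lra).
      apply Rmult_lt_compat_r; [easy|].
      eapply Rlt_le_trans; [exact hw|apply Rmin_r].
Qed.

(** Averaging over the four points cancels the terms of degree 1, 2 and 3,
    because the first three power sums of 1, i, -1, -i vanish. *)
Lemma four_point_mean (U : C -> Prop) (f : C -> X) (z : C) :
  analytic_on U f -> U z ->
  exists r D, 0 < r /\ forall t, 0 < t < r ->
    4 * norm (f z) <= norm (f (z + RtoC t)%C) + norm (f (z + Ci * RtoC t)%C)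
      + norm (f (z - RtoC t)%C) + norm (f (z - Ci * RtoC t)%C) + D * t ^ 4.
Proof.
  intros Hf hz.
  destruct (analytic_on_remainders _ U f z Hf hz)
    as (a & r & M & rate & hr & hR & H).
  exists r, (4 * (M * rate ^ 4)); split; [easy|]. intros t ht.
  assert (fz : f z = a 0%nat).
  { destruct (H (RtoC 0)) as (y & y0 & rec & _); [now rewrite Cmod_0|].
    replace (z + RtoC 0)%C with z in y0 by ring.
    rewrite <- y0, (rec 0%nat). vring X. }
  (* Taylor expansion to order three, with u the fourth remainder. *)
  assert (T : forall h : C, Cmod h = t -> exists u : X, norm u <= M * rate ^ 4 /\
    f (z + h)%C = plus (a 0%nat) (plus (h *: a 1%nat) (plus ((h * h)%C *: a 2%nat)
      (plus ((h * h * h)%C *: a 3%nat) ((h * h * h * h)%C *: u))))).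
  { intros h hh. destruct (H h) as (y & y0 & rec & bound); [lra|].
    exists (y 4%nat); split; [apply bound|].
    rewrite <- y0, (rec 0%nat), (rec 1%nat), (rec 2%nat), (rec 3%nat). vring X. }
  assert (ct : Cmod (RtoC t) = t) by (rewrite Cmod_R, Rabs_right; lra).
  pose proof Cmod_Ci as ci.
  destruct (T (RtoC t) ct) as (u1 & b1 & e1).
  destruct (T (Ci * RtoC t)%C) as (u2 & b2 & e2); [rewrite Cmod_mult; nra|].
  destruct (T (- RtoC t)%C) as (u3 & b3 & e3); [now rewrite Cmod_opp|].
  destruct (T (- (Ci * RtoC t))%C) as (u4 & b4 & e4);
    [rewrite Cmod_opp, Cmod_mult; nra|].
  fold (z - RtoC t)%C in e3. fold (z - Ci * RtoC t)%C in e4.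
  set (f1 := f (z + RtoC t)%C) in *. set (f2 := f (z + Ci * RtoC t)%C) in *.
  set (f3 := f (z - RtoC t)%C) in *. set (f4 := f (z - Ci * RtoC t)%C) in *.
  assert (E : RtoC 4 *: f z = plus (plus (plus f1 f2) (plus f3 f4))
                ((- RtoC (t ^ 4))%C *: plus (plus u1 u2) (plus u3 u4))).
  { rewrite fz, e1, e2, e3, e4. compare_coefficients X;
      apply injective_projections; simpl; ring. }
  assert (N : 4 * norm (f z) <= norm (RtoC 4 *: f z)).
  { pose proof (norm_scal_le X (/ RtoC 4)%C (RtoC 4 *: f z)) as n.
    replace ((/ RtoC 4)%C *: (RtoC 4 *: f z)) with (f z) in n.
    - assert (c4 : Cmod (/ RtoC 4) = / 4).
      { rewrite Cmod_inv, Cmod_R, Rabs_right; [easy|lra|].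
        intros Q; apply RtoC_inj in Q; lra. }
      rewrite c4 in n. lra.
    - vfield X. }
  eapply Rle_trans; [exact N|]. rewrite E.
  eapply Rle_trans; [apply norm_plus_le|]. apply Rplus_le_compat.
  - eapply Rle_trans; [apply norm_plus_le|].
    pose proof (norm_plus_le X f1 f2). pose proof (norm_plus_le X f3 f4). lra.
  - eapply Rle_trans; [apply norm_scal_le|].
    pose proof (pow_lt t 4 (proj1 ht)) as pt.
    rewrite Cmod_opp, Cmod_R, Rabs_right, Rmult_comm by lra.
    apply Rmult_le_compat_r; [lra|].
    eapply Rle_trans; [apply norm_plus_le|].
    pose proof (norm_plus_le X u1 u2). pose proof (norm_plus_le X u3 u4). lra.
Qed.

End Inversion.

(** * Compact sets and the maximum principle *)

(** If no point of K were a maximum, the open sets on which phi stays below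
    phi t, for t in K, would cover K; the largest of the finitely many t of a
    subcover would lie in none of them. *)
Lemma compact_set_max (K : C -> Prop) (phi : C -> R) :
  compact_set K -> (exists z, K z) ->
  (forall z e, K z -> 0 < e -> locally z (fun w => phi w < phi z + e)) ->
  exists z0, K z0 /\ forall z, K z -> phi z <= phi z0.
Proof.
  intros HK [k hk] usc. apply NNPP; intros no.
  assert (above : forall z, K z -> exists t, K t /\ phi z < phi t).
  { intros z hz. apply NNPP; intros H. apply no. exists z; split; [easy|].
    intros t ht. apply Rnot_lt_le; intros l. apply H. now exists t. }
  destruct (HK (fun O => open O /\
      exists t, K t /\ forall w, O w -> phi w < phi t)) as (L & FL & cover).
  - now intros O [HO _].
  - intros z hz. destruct (above z hz) as (t & ht & l).
    exists (fun w => locally w (fun v => phi v < phi t)). split; [split|].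
    + intros w hw. now apply locally_locally.
    + exists t; split; [easy|]. intros w hw. exact (locally_singleton w _ hw).
    + apply (filter_imp (fun w => phi w < phi z + (phi t - phi z))).
      * intros w hw; lra.
      * apply usc; [easy|lra].
  - assert (M : exists t, K t /\
      forall O, In O L -> forall w, O w -> phi w < phi t).
    { clear cover. induction L as [|O L IH]; [now exists k|].
      destruct IH as (t & ht & Ht); [now intros O' h; apply FL; right|].
      destruct (FL O) as (_ & s & hs & Hs); [now left|].
      destruct (Rle_dec (phi s) (phi t)) as [l|l].
      - exists t; split; [easy|]. intros O' [<-|h] w hw.
        + specialize (Hs w hw); lra.
        + exact (Ht O' h w hw).
      - exists s; split; [easy|]. intros O' [<-|h] w hw.
        + exact (Hs w hw).
        + specialize (Ht O' h w hw); lra. }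
    destruct M as (t & ht & Ht). destruct (cover t ht) as (O & hO & hw).
    specialize (Ht O hO t hw); lra.
Qed.

Definition square (c : C) (r : R) (z : C) : Prop :=
  Rabs (fst z - fst c) <= r /\ Rabs (snd z - snd c) <= r.

(** Gauge form of the Heine-Borel theorem: each centre t is given a size on which
    one member of the cover suffices. *)
Lemma square_compact (c : C) (r : R) : compact_set (square c r).
Proof.
  intros F HF cover.
  assert (D : forall t : C, exists p : posreal * (C -> Prop), square c r t ->
    F (snd p) /\ forall w : C, Rabs (fst w - fst t) < fst p ->
      Rabs (snd w - snd t) < fst p -> snd p w).
  { intros t. destruct (classic (square c r t)) as [ht|ht].
    - destruct (cover t ht) as (O & hO & Ot).
      destruct (HF O hO t Ot) as [d Hd]. exists (d, O); intros _.
      split; [easy|]. intros w h1 h2. apply Hd. now split.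
    - (* Centres outside the square get arbitrary data. *)
      now exists (mkposreal 1 Rlt_0_1, fun _ => True). }
  destruct (choice _ D) as [p Hp].
  set (pt := fun x : Compactness.Tn 2 R => (fst x, fst (snd x)) : C).
  destruct (NNPP _ (compactness_list 2 (fst c - r, (snd c - r, tt))
    (fst c + r, (snd c + r, tt)) (fun x => fst (p (pt x))))) as [L HL].
  assert (box : forall x : Compactness.Tn 2 R,
    bounded_n 2 (fst c - r, (snd c - r, tt)) (fst c + r, (snd c + r, tt)) x <->
    square c r (pt x)).
  { intros (x1 & x2 & []). unfold pt, square; cbn.
    rewrite !Rabs_le_between'. tauto. }
  exists (map (fun x => snd (p (pt x)))
            (filter (fun x => if excluded_middle_informative (square c r (pt x))
                              then true else false) L)).
  split.
  - intros O hO. apply in_map_iff in hO as (x & <- & hx).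
    apply filter_In in hx as [_ hx].
    destruct (excluded_middle_informative (square c r (pt x))) as [q|]; [|easy].
    apply (Hp (pt x) q).
  - intros z hz. destruct (HL (fst z, (snd z, tt))) as (x & hx & bx & cx).
    { apply box. unfold pt; cbn. destruct z; exact hz. }
    apply box in bx.
    exists (snd (p (pt x))); split.
    + apply in_map_iff. exists x; split; [easy|]. apply filter_In; split; [easy|].
      now destruct (excluded_middle_informative (square c r (pt x))).
    + apply (Hp (pt x) bx).
      * destruct x as (x1 & x2 & []). apply cx.
      * destruct x as (x1 & x2 & []). apply cx.
Qed.

Lemma disc_in_square (c : C) (r : R) (z : C) :
  Cmod (z - c) < r -> square c r z.
Proof.
  intros h. pose proof (Rmax_Cmod (z - c)%C) as m. split.
  - pose proof (Rmax_l (Rabs (fst (z - c)%C)) (Rabs (snd (z - c)%C))) as l.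
    change (fst (z - c)%C) with (fst z - fst c) in l at 1. lra.
  - pose proof (Rmax_r (Rabs (fst (z - c)%C)) (Rabs (snd (z - c)%C))) as l.
    change (snd (z - c)%C) with (snd z - snd c) in l at 1. lra.
Qed.

Lemma square_in_disc (c : C) (r : R) (z : C) :
  square c r z -> 0 < r -> Cmod (z - c) < 2 * r.
Proof.
  intros [h1 h2] hr. eapply Rle_lt_trans; [apply Cmod_2Rmax|].
  assert (Rmax (Rabs (fst (z - c)%C)) (Rabs (snd (z - c)%C)) <= r)
    by now apply Rmax_lub.
  assert (sqrt 2 < 2).
  { rewrite <- (sqrt_square 2) at 2 by lra. apply sqrt_lt_1; lra. }
  pose proof (sqrt_pos 2).
  apply Rle_lt_trans with (sqrt 2 * r); [now apply Rmult_le_compat_l|].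
  now apply Rmult_lt_compat_r.
Qed.

Section UniformLimits.

Variable X : CompleteNormedModule C_AbsRing.

(** The function |f z| + eps |z|^2 attains its maximum over K.  At an interior
    point the four point mean would give 4 eps t^2 <= D t^4 for all small t.  So
    the maximum is attained where f is bounded by M; then let eps tend to 0. *)
Lemma maximum_principle (U K : C -> Prop) (f : C -> X) (M : R) :
  analytic_on U f -> compact_set K -> (forall z, K z -> U z) ->
  (forall z, K z -> ~ locally z K -> norm (f z) <= M) ->
  forall z, K z -> norm (f z) <= M.
Proof.
  intros Hf HK KU HM z hz.
  set (q := fun w : C => fst w * fst w + snd w * snd w).
  assert (qpos : forall w, 0 <= q w) by (intros w; unfold q; nra).
  assert (qusc : forall w e, 0 < e -> locally w (fun v => q v < q w + e)).
  { intros w e he.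
    assert (cq : continuous q w).
    { apply (continuous_plus (fun v : C => fst v * fst v) (fun v : C => snd v * snd v));
        [apply (continuous_mult (fun v : C => fst v) (fun v : C => fst v))
        |apply (continuous_mult (fun v : C => snd v) (fun v : C => snd v))];
        first [apply continuous_fst | apply continuous_snd]. }
    apply (cq (fun x => x < q w + e)). exists (mkposreal e he). intros x hx.
    apply Rabs_lt_between in hx. cbn in hx. unfold minus, plus, opp in hx; cbn in hx.
    lra. }
  destruct (compact_set_max K q HK) as (zb & _ & qmax);
    [now exists z|now intros w e _; apply qusc|].
  set (B := q zb) in *. pose proof (qpos zb : 0 <= B) as Bpos.
  apply le_epsilon; intros e he.
  set (eps := e / (B + 1)).
  assert (epos : 0 < eps) by (apply Rdiv_lt_0_compat; lra).
  assert (eB : eps * B <= e).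
  { replace e with (eps * (B + 1)) by (unfold eps; field; lra). nra. }
  set (phi := fun w => norm (f w) + eps * q w).
  destruct (compact_set_max K phi HK) as (z0 & h0 & Hmax); [now exists z| |].
  { intros w d hw hd.
    apply (filter_imp (fun v => norm (f v) < norm (f w) + d / 2 /\
                                q v < q w + d / 2 / eps)).
    - intros v [h1 h2]. unfold phi. apply (Rmult_lt_compat_l eps) in h2; [|easy].
      replace (eps * (q w + d / 2 / eps)) with (eps * q w + d / 2) in h2
        by (field; lra).
      lra.
    - apply filter_and.
      + apply (analytic_norm_upper_semicontinuous X U); [easy|now apply KU|lra].
      + apply qusc. apply Rdiv_lt_0_compat; lra. }
  destruct (classic (locally z0 K)) as [inside|border].
  - exfalso. apply locally_Cmod in inside; destruct inside as (d & hd & Hd).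
    destruct (four_point_mean X U f z0 Hf (KU z0 h0)) as (r & D & hr & Hr).
    assert (hD : 0 < eps / (Rabs D + 1)).
    { apply Rdiv_lt_0_compat; [easy|]. pose proof (Rabs_pos D); lra. }
    (* This t makes D t^4 at most eps t^2, less than the gain 4 eps t^2. *)
    set (t := Rmin (Rmin (r / 2) (d / 2)) (Rmin 1 (eps / (Rabs D + 1)))).
    assert (tpos : 0 < t) by (repeat apply Rmin_pos; lra).
    assert (t1 : t <= r / 2)
      by (eapply Rle_trans; [apply Rmin_l|]; apply Rmin_l).
    assert (t2 : t <= d / 2)
      by (eapply Rle_trans; [apply Rmin_l|]; apply Rmin_r).
    assert (t3 : t <= 1) by (eapply Rle_trans; [apply Rmin_r|]; apply Rmin_l).
    assert (t4 : t <= eps / (Rabs D + 1))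
      by (eapply Rle_trans; [apply Rmin_r|]; apply Rmin_r).
    assert (Dt : D * t ^ 4 <= eps * t ^ 2).
    { apply (Rmult_le_compat_r (Rabs D + 1)) in t4; [|pose proof (Rabs_pos D); lra].
      replace (eps / (Rabs D + 1) * (Rabs D + 1)) with eps in t4
        by (field; pose proof (Rabs_pos D); lra).
      pose proof (Rle_abs D). pose proof (Rabs_pos D).
      assert (D * t ^ 2 <= eps) by nra.
      replace (D * t ^ 4) with (D * t ^ 2 * t ^ 2) by ring.
      apply Rmult_le_compat_r; [nra|easy]. }
    assert (ct : Cmod (RtoC t) = t) by (rewrite Cmod_R, Rabs_right; lra).
    pose proof Cmod_Ci as ci.
    assert (near : forall h : C, Cmod h = t -> phi (z0 + h)%C <= phi z0).
    { intros h hh. apply Hmax, Hd. replace (z0 + h - z0)%C with h by ring. lra. }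
    pose proof (near (RtoC t) ct) as n1.
    pose proof (near (Ci * RtoC t)%C ltac:(rewrite Cmod_mult; nra)) as n2.
    pose proof (near (- RtoC t)%C ltac:(now rewrite Cmod_opp)) as n3.
    pose proof (near (- (Ci * RtoC t))%C
                  ltac:(rewrite Cmod_opp, Cmod_mult; nra)) as n4.
    fold (z0 - RtoC t)%C in n3. fold (z0 - Ci * RtoC t)%C in n4.
    specialize (Hr t ltac:(lra)).
    assert (Q : q (z0 + RtoC t)%C + q (z0 + Ci * RtoC t)%C + q (z0 - RtoC t)%C
                + q (z0 - Ci * RtoC t)%C = 4 * q z0 + 4 * t ^ 2)
      by (unfold q; simpl; ring).
    unfold phi in n1, n2, n3, n4.
    apply (f_equal (Rmult eps)) in Q. pose proof (pow_lt t 2 tpos). nra.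
  - specialize (HM z0 h0 border). specialize (Hmax z hz). unfold phi in Hmax.
    specialize (qmax z0 h0). specialize (qpos z). nra.
Qed.

(** * Locally uniform convergence to zero *)

Lemma uniform_null_dominated (K : C -> Prop) (g g' : nat -> C -> X) (c : R) :
  (forall n z, K z -> norm (g' n z) <= c * norm (g n z)) ->
  uniform_null_on K g -> uniform_null_on K g'.
Proof.
  intros dom H eps he. pose proof (Rabs_pos c) as pc. pose proof (Rle_abs c) as lc.
  destruct (H (eps / (Rabs c + 1))) as [N HN]; [apply Rdiv_lt_0_compat; lra|].
  exists N; intros n hn z hz. eapply Rle_lt_trans; [now apply dom|].
  specialize (HN n hn z hz). pose proof (norm_pos X (g n z)) as p.
  apply (Rmult_lt_compat_l (Rabs c + 1)) in HN; [|lra].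
  replace ((Rabs c + 1) * (eps / (Rabs c + 1))) with eps in HN by (field; lra).
  change (c * norm (g n z) < eps). nra.
Qed.

Lemma uniform_null_subset (K K' : C -> Prop) (g : nat -> C -> X) :
  (forall z, K' z -> K z) -> uniform_null_on K g -> uniform_null_on K' g.
Proof.
  intros S H eps he. destruct (H eps he) as [N HN].
  exists N; intros n hn z hz. apply HN; auto.
Qed.

Lemma uniform_null_plus (K : C -> Prop) (g g' : nat -> C -> X) :
  uniform_null_on K g -> uniform_null_on K g' ->
  uniform_null_on K (fun n z => plus (g n z) (g' n z)).
Proof.
  intros H H' eps he.
  destruct (H (eps / 2)) as [N HN]; [lra|].
  destruct (H' (eps / 2)) as [N' HN']; [lra|].
  exists (N + N')%nat; intros n hn z hz.
  eapply Rle_lt_trans; [apply norm_plus_le|].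
  specialize (HN n ltac:(lia) z hz). specialize (HN' n ltac:(lia) z hz). lra.
Qed.

Definition locally_uniformly_null (U : C -> Prop) (g : nat -> C -> X) : Prop :=
  forall z, U z -> exists O : C -> Prop, locally z O /\ uniform_null_on O g.

Lemma locally_uniformly_null_compact (U : C -> Prop) (g : nat -> C -> X) :
  open U ->
  (locally_uniformly_null U g <->
   forall K, compact_set K -> (forall z, K z -> U z) -> uniform_null_on K g).
Proof.
  intros HU; split.
  - intros H K HK KU.
    destruct (HK (fun O => open O /\ uniform_null_on O g)) as (L & FL & cover).
    + now intros O [HO _].
    + intros z hz. destruct (H z (KU z hz)) as (O & hO & N).
      exists (fun w => locally w O); split; [split|exact hO].
      * intros w hw. now apply locally_locally.
      * apply (uniform_null_subset O); [|easy].
        intros w hw. exact (locally_singleton w _ hw).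
    + apply (uniform_null_subset (fun z => exists O, In O L /\ O z)); [exact cover|].
      clear cover. intros eps he. induction L as [|O L IH].
      * exists 0%nat. now intros n _ z (O & [] & _).
      * destruct IH as [N HN]; [now intros O' h; apply FL; right|].
        destruct (proj2 (FL O (or_introl eq_refl)) eps he) as [N' HN'].
        exists (N + N')%nat. intros n hn z (O' & [<-|h] & hz).
        -- apply HN'; [lia|easy].
        -- apply HN; [lia|]. now exists O'.
  - intros H z hz.
    destruct (proj1 (locally_Cmod z U) (HU z hz)) as (d & hd & Hd).
    exists (square z (d / 2)); split.
    + apply locally_Cmod. exists (d / 2); split; [lra|].
      intros w hw. now apply disc_in_square.
    + apply H; [apply square_compact|]. intros w hw. apply Hd.
      apply square_in_disc in hw; lra.
Qed.

(** Away from 0 the factor z is bounded below.  Around 0 the points of a square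
    that are not interior to it satisfy the same lower bound, and the maximum
    principle carries the estimate to the inside. *)
Lemma locally_uniformly_null_quotient (U : C -> Prop) (g : nat -> C -> X) :
  open U -> (forall n, analytic_on U (g n)) ->
  locally_uniformly_null U (fun n z => z *: g n z) -> locally_uniformly_null U g.
Proof.
  intros HU Hg H z hz.
  assert (away : forall rho (O : C -> Prop), 0 < rho ->
    uniform_null_on O (fun n w => w *: g n w) ->
    uniform_null_on (fun w => O w /\ rho <= Cmod w) g).
  { intros rho O hr N. apply (uniform_null_dominated _ (fun n w => w *: g n w) _ (/ rho)).
    - intros n w [_ hw].
      assert (nw : w <> RtoC 0) by (apply Cmod_gt_0; lra).
      replace (g n w) with ((/ w)%C *: (w *: g n w)) at 1 by (vfield X; exact nw).
      eapply Rle_trans; [apply norm_scal_le|].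
      apply Rmult_le_compat_r; [apply norm_pos|].
      rewrite Cmod_inv by easy. now apply Rinv_le_contravar.
    - apply (uniform_null_subset O); [now intros w []|easy]. }
  destruct (classic (z = RtoC 0)) as [->|nz].
  - destruct (proj1 (locally_Cmod _ U) (HU _ hz)) as (d & hd & Hd).
    set (K := square (RtoC 0) (d / 2)).
    assert (HK : compact_set K) by apply square_compact.
    assert (KU : forall w, K w -> U w).
    { intros w hw. apply Hd. apply square_in_disc in hw; lra. }
    exists K; split.
    + apply locally_Cmod. exists (d / 2); split; [lra|].
      intros w hw. now apply disc_in_square.
    + pose proof (away (d / 2) K ltac:(lra)
        (proj1 (locally_uniformly_null_compact U _ HU) H K HK KU)) as N.
      intros eps he. destruct (N (eps / 2)) as [n0 Hn]; [lra|].
      exists n0; intros n hn w hw.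
      apply Rle_lt_trans with (eps / 2); [|lra].
      apply (maximum_principle U K (g n) (eps / 2) (Hg n) HK KU); [|easy].
      intros v hv border. left. apply Hn; [easy|]. split; [easy|].
      apply Rnot_lt_le; intros l. apply border.
      apply (filter_imp (fun w => Cmod (w - RtoC 0) < d / 2)).
      * intros x hx. now apply disc_in_square.
      * apply open_disc. now rewrite Cminus_0_r.
  - destruct (H z hz) as (O & hO & N).
    pose proof (proj1 (Cmod_gt_0 z) nz) as pz.
    exists (fun w => O w /\ Cmod z / 2 <= Cmod w); split; [|apply away; [lra|easy]].
    apply filter_and; [easy|].
    apply locally_Cmod. exists (Cmod z / 2); split; [lra|].
    intros w hw. pose proof (Cmod_triangle w (- (w - z))) as t.
    rewrite Cmod_opp in t. replace (w + - (w - z))%C with z in t by ring. lra.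
Qed.

End UniformLimits.

(** * Local resolvent sets *)

Section LocalSpectra.

Variable X : CompleteNormedModule C_AbsRing.

Lemma local_resolvent_plus (T : X -> X) (x y : X) (z : C) :
  is_linear T -> local_resolvent_set T x z -> local_resolvent_set T y z ->
  local_resolvent_set T (plus x y) z.
Proof.
  intros HT (U & HU & hU & f & Hf & Ef) (V & HV & hV & g & Hg & Eg).
  exists (fun w => U w /\ V w); split; [now apply open_and|split; [easy|]].
  exists (fun w => plus (f w) (g w)); split.
  - apply analytic_on_plus.
    + apply (analytic_on_subset X U); [now intros w []|easy].
    + apply (analytic_on_subset X V); [now intros w []|easy].
  - intros w [h1 h2]. rewrite <- (Ef w h1), <- (Eg w h2). unfold shift.
    rewrite (map_plus X T _ _ HT). vring X.
Qed.

Lemma local_resolvent_map (T L : X -> X) (x : X) (z : C) :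
  is_linear L -> (forall x, L (T x) = T (L x)) ->
  local_resolvent_set T x z -> local_resolvent_set T (L x) z.
Proof.
  intros HL comm (U & HU & hU & f & Hf & Ef).
  exists U; split; [easy|split; [easy|]].
  exists (fun w => L (f w)); split; [now apply analytic_on_linear|].
  intros w hw. rewrite <- (Ef w hw). unfold shift.
  now rewrite (map_minus X L _ _ HL), (map_scal X L _ _ HL), comm.
Qed.

(** The local resolvent function is x / z. *)
Lemma local_resolvent_kernel (T : X -> X) (x : X) (z : C) :
  is_linear T -> T x = zero -> z <> RtoC 0 -> local_resolvent_set T x z.
Proof.
  intros HT Tx hz.
  exists (fun w => w <> RtoC 0 /\ True).
  split; [apply (open_inverse (fun _ => True)), open_true|split; [easy|]].
  exists (fun w => (/ w)%C *: x); split.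
  - apply (analytic_on_inverse X (fun _ => True) (fun _ => x)).
    apply analytic_on_of_remainders. intros z0 _.
    set (a := fun n : nat => match n with O => x | S _ => zero end).
    exists a, 1, 1; split; [lra|split; [lra|]]. intros h _.
    exists a, (norm x); split; [easy|split]; intros [|j]; cbn [a].
    + vring X.
    + vring X.
    + simpl; lra.
    + rewrite pow1. eapply Rle_trans; [right; exact (@norm_zero _ X)|].
      pose proof (norm_pos X x). lra.
  - intros w [hw _]. unfold shift. rewrite (map_scal X T _ _ HT), Tx.
    vfield X; exact hw.
Qed.

(** On the range of the idempotent A B, A is the inverse of B, so that
    - A (1 - z A)^-1 is the resolvent of B. *)
Lemma local_resolvent_near_zero (A B : X -> X) (beta : R) (x : X) (z : C) :
  is_linear A -> is_linear B -> (forall x, A (B x) = B (A x)) ->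
  (forall x, A (B (A (B x))) = A (B x)) ->
  0 < beta -> (forall x, norm (A x) <= beta * norm x) -> Cmod z * beta < 1 ->
  local_resolvent_set B (A (B x)) z.
Proof.
  intros HA HB comm idem hb bA hz.
  destruct (neumann_analytic X A beta (A (B x)) HA hb bA) as (f & Hf & Ef).
  exists (fun w => Cmod w * beta < 1); split; [|split; [easy|]].
  { intros w hw.
    apply (filter_imp (fun v : C => Cmod (v - RtoC 0) < / beta)).
    - intros v hv. rewrite Cminus_0_r in hv.
      apply (Rmult_lt_compat_r beta) in hv; [|easy].
      now rewrite Rinv_l in hv by lra.
    - apply open_disc. rewrite Cminus_0_r.
      apply (Rmult_lt_reg_r beta); [easy|]. now rewrite Rinv_l by lra. }
  exists (fun w => opp (A (A (B (f w))))); split.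
  - apply (analytic_on_linear X _ f (fun u => opp (A (A (B u))))); [|easy].
    apply (is_linear_comp (fun u => A (A (B u))) opp); [|apply is_linear_opp].
    apply (is_linear_comp (fun u => A (B u)) A); [|easy].
    now apply (is_linear_comp B A).
  - intros w hw. rewrite <- (idem x), <- (Ef w hw). unfold shift.
    rewrite (map_minus X B _ _ HB), (map_minus X A _ _ HA),
      (map_scal X B _ _ HB), (map_scal X A _ _ HA).
    replace (B (opp (A (A (B (f w)))))) with (opp (B (A (A (B (f w)))))).
    2: { transitivity (RtoC (-1) *: B (A (A (B (f w))))); [vring X|].
         rewrite <- (map_scal X B _ _ HB). f_equal. vring X. }
    rewrite <- (comm (A (B (f w)))), idem, <- (comm (f w)). vring X.
Qed.

End LocalSpectra.

(** * Inverse operators on the range of an idempotent *)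

Section InverseOnRange.

Variable X : CompleteNormedModule C_AbsRing.
Variables T S : X -> X.
Hypothesis HT : is_linear T.
Hypothesis HS : is_linear S.
Hypothesis comm : forall x, S (T x) = T (S x).
Hypothesis reflexive : forall x, S (T (S x)) = S x.

Let P (x : X) : X := T (S x).

Lemma linear_P : is_linear P.
Proof. now apply (is_linear_comp S T). Qed.

Lemma PP x : P (P x) = P x.
Proof. unfold P. now rewrite reflexive. Qed.

Lemma ST_idem x : S (T (S (T x))) = S (T x).
Proof. now rewrite reflexive. Qed.

(** If (1/w - T) u = x, then - T P (u / w) solves the equation for S at w,
    because S T P = P. *)
Lemma local_resolvent_inverse (x : X) (z : C) :
  z <> RtoC 0 -> local_resolvent_set T x (/ z)%C -> local_resolvent_set S (P x) z.
Proof.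
  intros hz (U & HU & hU & f & Hf & Ef).
  exists (fun w => w <> RtoC 0 /\ U (/ w)%C).
  split; [now apply open_inverse|split; [easy|]].
  set (L := fun u => opp (T (P u))).
  exists (fun w => L ((/ w)%C *: f (/ w)%C)); split.
  - apply analytic_on_linear; [|now apply analytic_on_inverse].
    apply (is_linear_comp (fun u => T (P u)) opp); [|apply is_linear_opp].
    apply (is_linear_comp P T); [apply linear_P|easy].
  - intros w [nw hw]. rewrite <- (Ef _ hw). set (u := f (/ w)%C). unfold shift, L.
    replace (S (opp (T (P ((/ w)%C *: u))))) with (opp (P ((/ w)%C *: u))).
    + rewrite (map_minus X P _ _ linear_P), !(map_scal X P _ _ linear_P),
        (map_scal X T _ _ HT).
      replace (P (T u)) with (T (P u)) by (unfold P; now rewrite comm).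
      vfield X; exact nw.
    + transitivity (RtoC (-1) *: S (T (P ((/ w)%C *: u)))).
      * unfold P at 2. rewrite comm, reflexive. fold (P ((/ w)%C *: u)). vring X.
      * rewrite <- (map_scal X S _ _ HS). f_equal. vring X.
Qed.

(** The image of W under inversion, with a disc around 0 adjoined because
    inversion maps no point to 0. *)
Definition inverse_neighbourhood (e : R) (W : C -> Prop) (z : C) : Prop :=
  Cmod (z - RtoC 0) < e \/ z <> RtoC 0 /\ W (/ z)%C.

(** Suppose that z lies outside the closure of W.  If z = 0, the Neumann series
    in T puts 0 in the local resolvent set of P u for S.  Otherwise, if 1/z is small, the Neumann
    series shows that it is in the local resolvent set of P u for T; if not,
    1/z is away from the adjoined disc and so outside the closure of the
    neighbourhood.  The radius of the disc is half that of the Neumann series,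
    which leaves room around 1/z. *)
Lemma local_spectral_subspace_inverse (W : C -> Prop) (beta : R) (u : X) :
  0 < beta -> (forall x, norm (S x) <= beta * norm x) ->
  local_spectral_subspace T (closure (inverse_neighbourhood (/ (2 * beta)) W)) u ->
  local_spectral_subspace S (closure W) (P u).
Proof.
  intros hb bS Hu z hz. apply NNPP; intros out. apply hz.
  destruct (classic (z = RtoC 0)) as [->|nz].
  { destruct (linear_norm T HT) as (c & hc & bT).
    apply (local_resolvent_near_zero X T S c); try assumption.
    - intros x'. now rewrite comm.
    - intros x'. apply PP.
    - rewrite Cmod_0; lra. }
  assert (niz : (/ z)%C <> RtoC 0) by now apply Cinv_nonzero.
  assert (iiz : (/ / z)%C = z) by now apply Cinv_involutive.
  rewrite <- PP. apply local_resolvent_inverse; [easy|].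
  destruct (Rlt_dec (Cmod (/ z) * beta) 1) as [small|large].
  { unfold P. rewrite <- comm.
    apply (local_resolvent_near_zero X S T beta); try assumption.
    apply ST_idem. }
  apply local_resolvent_map; [apply linear_P|intros x'; unfold P; now rewrite comm|].
  apply NNPP; intros sp. specialize (Hu _ sp).
  apply out. intros N HN.
  rewrite <- iiz in HN. apply locally_inverse in HN; [|easy].
  destruct (Hu (fun w => (w <> RtoC 0 /\ N (/ w)%C) /\ / (2 * beta) <= Cmod w))
    as (w & [[nw hw] bw] & [hd|[_ hW]]).
  - apply filter_and; [easy|].
    assert (i : 0 < / (2 * beta)) by (apply Rinv_0_lt_compat; lra).
    assert (l : 2 * / (2 * beta) <= Cmod (/ z)).
    { apply Rnot_lt_le; intros Q. apply large.
      apply (Rmult_lt_compat_r beta) in Q; [|easy].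
      replace (2 * / (2 * beta) * beta) with 1 in Q by (field; lra). easy. }
    apply locally_Cmod. exists (/ (2 * beta)); split; [easy|].
    intros w hw. pose proof (Cmod_triangle w (- (w - / z))) as t.
    rewrite Cmod_opp in t. replace (w + - (w - / z))%C with (/ z)%C in t by ring. lra.
  - rewrite Cminus_0_r in hd. lra.
  - now exists (/ w)%C.
Qed.

(** The decomposition for T of x with respect to the transported cover is
    projected by P; the kernel component x - P x goes with the set that
    contains 0. *)
Lemma property_delta_inverse : property_delta T -> property_delta S.
Proof.
  intros delta.
  destruct (linear_norm S HS) as (beta & hb & bS).
  set (ext := inverse_neighbourhood (/ (2 * beta))).
  assert (ext_open : forall W, open W -> open (ext W)).
  { intros W HW. apply open_or; [apply open_disc|now apply open_inverse]. }
  assert (ext_in : forall W (z : C), W (/ z)%C -> ext W z).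
  { intros W z h. destruct (classic (z = RtoC 0)) as [->|nz]; [|now right].
    left. rewrite Cminus_0_r, Cmod_0.
    apply Rinv_0_lt_compat; lra. }
  assert (ker : forall W x, W (RtoC 0) ->
    local_spectral_subspace S (closure W) (minus x (P x))).
  { intros W x h0 z hz. destruct (classic (z = RtoC 0)) as [->|nz].
    - intros N HN. exists (RtoC 0); split; [exact (locally_singleton _ _ HN)|easy].
    - exfalso. apply hz. apply local_resolvent_kernel; [easy| |easy].
      rewrite (map_minus X S _ _ HS). unfold P. rewrite reflexive. vring X. }
  assert (sum : forall (W : C -> Prop) x y, local_spectral_subspace S W x ->
    local_spectral_subspace S W y -> local_spectral_subspace S W (plus x y)).
  { intros W x y hx hy z hz. apply NNPP; intros out. apply hz.
    apply local_resolvent_plus; [easy| |]; apply NNPP; intros sp; apply out.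
    - exact (hx z sp).
    - exact (hy z sp). }
  intros U V HU HV cover x.
  destruct (delta (ext U) (ext V) (ext_open U HU) (ext_open V HV)) with (x := x)
    as (u & v & hu & hv & E).
  { intros z. destruct (cover (/ z)%C); [left|right]; now apply ext_in. }
  assert (ux : x = plus (plus (P u) (P v)) (minus x (P x))).
  { rewrite E at 3. rewrite (map_plus X P _ _ linear_P). vring X. }
  apply (local_spectral_subspace_inverse U beta u hb bS) in hu.
  apply (local_spectral_subspace_inverse V beta v hb bS) in hv.
  destruct (cover (RtoC 0)) as [h0|h0].
  - exists (plus (P u) (minus x (P x))), (P v).
    split; [apply sum; [easy|now apply ker]|split; [easy|]].
    rewrite ux at 1. vring X.
  - exists (P u), (plus (P v) (minus x (P x))).
    split; [easy|split; [apply sum; [easy|now apply ker]|]].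
    rewrite ux at 1. vring X.
Qed.

(** It suffices to treat z f_n, which splits into z P f_n and h_n - P h_n. *)
Lemma property_beta_inverse : property_beta T -> property_beta S.
Proof.
  intros beta U HU f Hf Hh.
  set (h := fun n z => shift S z (f n z)) in Hh.
  apply (locally_uniformly_null_compact X U h HU) in Hh.
  apply (locally_uniformly_null_compact X U f HU).
  apply locally_uniformly_null_quotient; [easy|easy|].
  destruct (linear_norm T HT) as (t & ht & bT).
  destruct (linear_norm P linear_P) as (p & hp & bP).
  intros z hz. destruct (Hh z hz) as (O & HO & N).
  assert (split_f : forall n w,
    w *: f n w = plus (w *: P (f n w)) (minus (h n w) (P (h n w)))).
  { intros n w. unfold h, shift.
    rewrite (map_minus X P _ _ linear_P), (map_scal X P _ _ linear_P).
    replace (P (S (f n w))) with (S (f n w))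
      by (unfold P; now rewrite <- comm, reflexive).
    vring X. }
  assert (NQ : uniform_null_on O (fun n w => minus (h n w) (P (h n w)))).
  { apply (uniform_null_dominated X O h _ (1 + p)); [|easy]. intros n w _.
    eapply Rle_trans; [apply norm_minus_le|]. pose proof (bP (h n w)) as b.
    rewrite Rmult_plus_distr_r, Rmult_1_l. apply Rplus_le_compat_l, b. }
  assert (NP : exists O', locally z O' /\
    uniform_null_on O' (fun n w => w *: P (f n w))).
  2: { destruct NP as (O' & HO' & N').
       exists (fun w => O w /\ O' w); split; [now apply filter_and|].
       intros eps he.
       destruct (uniform_null_plus X (fun w => O w /\ O' w) _ _
         (uniform_null_subset X _ _ _ (fun w q => proj2 q) N')
         (uniform_null_subset X _ _ _ (fun w q => proj1 q) NQ) eps he) as [n0 Hn].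
       exists n0. intros n hn w hw. rewrite split_f. now apply Hn. }
  assert (Th : forall n w, T (P (h n w)) = minus (w *: T (P (f n w))) (P (f n w))).
  { intros n w. unfold h, shift.
    rewrite (map_minus X P _ _ linear_P), (map_scal X P _ _ linear_P),
      (map_minus X T _ _ HT), (map_scal X T _ _ HT).
    f_equal. unfold P. now rewrite <- (comm (S (f n w))), reflexive. }
  assert (bTP : forall n w, norm (T (P (h n w))) <= t * p * norm (h n w)).
  { intros n w. eapply Rle_trans; [apply bT|]. rewrite Rmult_assoc.
    apply Rmult_le_compat_l; [lra|apply bP]. }
  destruct (classic (z = RtoC 0)) as [->|nz].
  - exists (fun w => O w /\ Cmod (w - RtoC 0) < / (2 * t)); split.
    { apply filter_and; [easy|]. apply open_disc.
      rewrite Cminus_0_r, Cmod_0.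
      apply Rinv_0_lt_compat; lra. }
    apply (uniform_null_dominated X _ h _ (/ (2 * t) * (2 * (t * p)))).
    2: apply (uniform_null_subset X O); [now intros w []|easy].
    intros n w [_ hw]. rewrite Cminus_0_r in hw.
    (* P f = w T P f - T P h, and the first term has norm at most |P f| / 2. *)
    assert (b : norm (P (f n w)) <= 2 * (t * p) * norm (h n w)).
    { assert (b1 : norm (P (f n w)) <= norm (w *: T (P (f n w)))
                                       + norm (opp (T (P (h n w))))).
      { apply norm_le_plus. rewrite Th. vring X. }
      rewrite norm_opp_eq in b1.
      assert (b2 : norm (w *: T (P (f n w))) <= / 2 * norm (P (f n w))).
      { eapply Rle_trans; [apply norm_scal_le|].
        apply Rle_trans with (/ (2 * t) * (t * norm (P (f n w)))).
        - apply Rmult_le_compat; [apply Cmod_ge_0|apply norm_pos|lra|apply bT].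
        - right; field; lra. }
      specialize (bTP n w). lra. }
    eapply Rle_trans; [apply norm_scal_le|]. rewrite Rmult_assoc.
    apply Rmult_le_compat; [apply Cmod_ge_0|apply norm_pos|lra|exact b].
  - set (V := fun m : C => m <> RtoC 0 /\ U (/ m)%C).
    assert (HV : open V) by now apply open_inverse.
    set (g := fun n m => P ((/ m)%C *: f n (/ m)%C)).
    assert (G : locally_uniformly_null X V g).
    { apply (locally_uniformly_null_compact X V g HV).
      apply (beta V HV g).
      - intros n. apply (analytic_on_linear X V _ P linear_P).
        now apply analytic_on_inverse.
      - apply (locally_uniformly_null_compact X V _ HV).
        intros m [nm hm]. destruct (Hh _ hm) as (O' & HO' & N').
        exists (fun w => w <> RtoC 0 /\ O' (/ w)%C).
        split; [now apply locally_inverse|].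
        intros eps he.
        destruct (uniform_null_dominated X O' h (fun n w => T (P (h n w))) (t * p)
          (fun n w _ => bTP n w) N' eps he) as [n0 Hn].
        exists n0. intros n hn w [nw hw].
        replace (shift T w (g n w)) with (opp (T (P (h n (/ w)%C)))).
        + rewrite norm_opp_eq. now apply Hn.
        + rewrite Th. unfold shift, g.
          rewrite (map_scal X P _ _ linear_P), (map_scal X T _ _ HT).
          vfield X; exact nw. }
    destruct (G (/ z)%C) as (O' & HO' & N').
    { split; [now apply Cinv_nonzero|]. now rewrite Cinv_involutive. }
    exists (fun w => w <> RtoC 0 /\ O' (/ w)%C); split; [now apply locally_inverse|].
    intros eps he. destruct (N' eps he) as [n0 Hn].
    exists n0. intros n hn w [nw hw]. specialize (Hn n hn _ hw).
    unfold g in Hn. rewrite Cinv_involutive in Hn by easy.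
    now rewrite (map_scal X P _ _ linear_P) in Hn.
Qed.

End InverseOnRange.

Theorem corollary4p9 (X : CompleteNormedModule C_AbsRing)
  (hX : infinite_dimensional X)
  (T TD : X -> X) (hT : is_linear T)
  (hTD : generalized_Drazin_inverse T TD) :
  (property_delta T -> property_delta TD) /\
  (decomposable T -> decomposable TD).
Proof.
  destruct hTD as (hS & comm & reflexive & _).
  assert (D : property_delta T -> property_delta TD)
    by now apply property_delta_inverse.
  split; [exact D|]. intros [b d]; split; [|now apply D].
  now apply (property_beta_inverse X T TD).
Qed.
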